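(* Let $\gamma$ be the cross topology on $\mathbb R\times\mathbb R$, let $\mathrm{nwd}_\gamma$ be the ideal of all $\gamma$-nowhere dense subsets of $\mathbb R\times\mathbb R$ and let $\mathcal M_\gamma$ be the $\sigma$-ideal of all $\gamma$-meager subsets of $\mathbb R\times\mathbb R$. Then $\mathrm{cof}(\mathrm{nwd}_\gamma)>2^{\omega}$ and $\mathrm{cof}(\mathcal M_\gamma)>2^{\omega}$.
   Context: The cross topology $\gamma$ on $\mathbb R\times\mathbb R$ is the family of all sets $G\subseteq\mathbb R\times\mathbb R$ such that all vertical sections $G_x=\{y:(x,y)\in G\}$ and all horizontal sections $G^y=\{x:(x,y)\in G\}$ are open in $\mathbb R$ (with its usual topology). For a family $\mathcal F$ of subsets of a set, $\mathrm{cof}(\mathcal F)$ is the minimal cardinality of a subfamily $\mathcal W\subseteq\mathcal F$ such that for every $Y\in\mathcal F$ there exists $Z\in\mathcal W$ with $Y\subseteq Z$. *)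

(* Defs.v *)
From HB Require Import structures.
From mathcomp Require Import all_boot all_order all_algebra.
From mathcomp Require Import boolp classical_sets functions cardinality.
From mathcomp Require Import reals topology normedtype.

Set Implicit Arguments.
Unset Strict Implicit.
Unset Printing Implicit Defensive.

Import numFieldNormedType.Exports.

Local Open Scope classical_set_scope.
Local Open Scope card_scope.

Definition card_lt T U (A : set T) (B : set U) : bool :=
  (A #<= B) && ~~ (B #<= A).
Notation "A '#<' B" := (card_lt A B)
  (at level 79, format "A  '#<'  B") : card_scope.

Definition cofinal_subfamily T (F W : set (set T)) : Prop :=
  W `<=` F /\ forall Y, F Y -> exists2 Z, W Z & Y `<=` Z.

(* A cardinal is represented by a set of that cardinality: cof F is a cofinal
   subfamily of least cardinality. The default value F of xget is never used,
   see cofP. *)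
Definition cof T (F : set (set T)) : set (set T) :=
  xget F [set W | cofinal_subfamily F W /\
                  forall W', cofinal_subfamily F W' -> W #<= W'].

Lemma min_card_le T (C : set (set T)) : C !=set0 ->
  exists2 A, C A & forall B, C B -> A #<= B.
Proof.
move=> [A0 CA0].
have [[A CA A_eq0]|nC0] := pselect (exists2 A, C A & A = set0).
  by exists A => // B _; rewrite A_eq0 card_ge0.
have C_neq0 A : C A -> A !=set0.
  by move=> CA; apply/set0P/eqP => A_eq0; apply: nC0; exists A.
have [t0 _] := C_neq0 _ CA0.
pose P (S : set (set T -> T)) :=
  (forall g B, S g -> C B -> B (g B)) /\
  (forall g h B B', S g -> S h -> C B -> C B' -> g B = h B -> g B' = h B').
have [|S [[SC Sinj] Smax]] := @Zorn_bigcup _ P.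
  move=> F FP Ftot; split=> [g B [X FX Xg]|g h B B' [X FX Xg] [Y FY Yh] CB CB'].
    by have [XC _] := FP _ FX; exact: XC.
  have [XY|YX] := Ftot _ _ FX FY.
    by have [_ Yinj] := FP _ FY; exact: Yinj (XY _ Xg) Yh CB CB'.
  by have [_ Xinj] := FP _ FX; exact: Xinj Xg (YX _ Yh) CB CB'.
have [[A CA SA]|nA] :=
    pselect (exists2 A, C A & forall a, A a -> exists2 g, S g & g A = a).
  exists A => // B CB.
  have /choice[f fP] a : exists g, A a -> S g /\ g A = a.
    have [/SA[g Sg gA]|nAa] := pselect (A a); first by exists g.
    by exists (fun=> t0).
  have fB : set_fun A B (fun a => f a B).
    by move=> a /fP[Sfa _]; exact: (SC (f a)).
  have finj : {in A &, injective (fun a => f a B)}.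
    move=> a b /set_mem/fP[Sa faA] /set_mem/fP[Sb fbA] fab.
    by rewrite -faA -fbA; exact: (Sinj (f a) (f b) B A).
  rewrite -(card_le_eql (inj_card_eq finj)).
  by apply: subset_card_le => _ [a Aa <-]; exact: fB.
exfalso.
have /choice[g gP] B : exists b, C B -> B b /\ forall h, S h -> h B <> b.
  have [CB|nCB] := pselect (C B); last by exists t0.
  apply: contrapT => nb; apply: nA; exists B => // b Bb.
  apply: contrapT => nh; apply: nb; exists b => _; split=> // h Sh hB.
  by apply: nh; exists h.
apply: (Smax (S `|` [set g])).
  split=> [|SgS]; first exact: subsetUl.
  have Sg : S g by apply: SgS; right.
  by have [_ /(_ _ Sg)] := gP _ CA0.
split=> [h B [Sh CB|-> CB]|h k B B' [Sh|->] [Sk|->] CB CB' //].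
- exact: (SC h).
- by have [] := gP _ CB.
- exact: (Sinj h k B B').
- by have [_ /(_ _ Sh)] := gP _ CB.
- by move/esym; have [_ /(_ _ Sk)] := gP _ CB.
Qed.

Lemma cofP T (F : set (set T)) : cofinal_subfamily F (cof F) /\
  forall W, cofinal_subfamily F W -> cof F #<= W.
Proof.
pose P := [set W | cofinal_subfamily F W /\
                   forall W', cofinal_subfamily F W' -> W #<= W'].
suff /(xgetPex F) : exists W, P W by [].
have [|W cofW minW] := @min_card_le _ [set W | cofinal_subfamily F W].
  by exists F; split=> // Y FY; exists Y.
by exists W.
Qed.

Definition nowhere_dense (T : topologicalType) (A : set T) : Prop :=
  interior (closure A) = set0.

Definition meager (T : topologicalType) (A : set T) : Prop :=
  exists2 N : nat -> set T,
    forall n, nowhere_dense (N n) & A = \bigcup_n N n.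

Definition nwd (T : topologicalType) : set (set T) := @nowhere_dense T.
Arguments nwd : clear implicits.

Definition meagers (T : topologicalType) : set (set T) := @meager T.
Arguments meagers : clear implicits.

(* An alias of the plane, so that it does not carry the product topology. *)
Definition cross_plane (R : realType) : Type := (R * R)%type.

Section cross_topology.
Variable R : realType.

HB.instance Definition _ := Choice.on (cross_plane R).

Definition cross_open : set (set (cross_plane R)) :=
  [set G : set (R * R) | (forall x : R, open (xsection G x)) /\
                         (forall y : R, open (ysection G y))].

Let cross_openT : cross_open setT.
Proof.
by split=> z; rewrite ?xsectionE ?ysectionE preimage_setT; exact: openT.
Qed.

Let cross_openI : setI_closed cross_open.
Proof.
by move=> A B [Ax Ay] [Bx By]; split=> z; rewrite ?xsectionI ?ysectionI;
  exact: openI.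
Qed.

Let cross_open_bigU (I : Type) (f : I -> set (cross_plane R)) :
  (forall i, cross_open (f i)) -> cross_open (\bigcup_i f i).
Proof.
move=> fo; split=> z; rewrite ?xsectionE ?ysectionE preimage_bigcup;
  apply: bigcup_open => i _; rewrite -?xsectionE -?ysectionE; apply fo.
Qed.

HB.instance Definition _ := isOpenTopological.Build (cross_plane R)
  cross_openT cross_openI cross_open_bigU.

Lemma open_crossE : @open (cross_plane R) = cross_open.
Proof. by []. Qed.

End cross_topology.

(* Main.v *)
(* A gamma-meager set M misses a point of the plane in general position with
   respect to any fewer than continuum many given points. Indeed, if G is
   gamma-open and gamma-dense, then for rationals p < q the x whose vertical
   section of G meets ]p, q[ form an open dense set, namely the union of the
   horizontal sections of G at heights in ]p, q[; hence comeagerly many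
   vertical sections of M have a comeager complement, and a comeager set of
   reals has the cardinality of the continuum. Given continuum many gamma-meager
   sets, transfinite recursion then picks a point outside each of them, no two
   on a common vertical or horizontal line. These points form a gamma-closed set
   with empty gamma-interior which none of the given sets contains. *)

Require Import Defs.
From mathcomp Require Import all_boot all_order all_algebra.
From mathcomp Require Import boolp classical_sets functions cardinality.
From mathcomp Require Import wochoice set_interval reals topology normedtype.
From mathcomp Require Import lra.

Set Implicit Arguments.
Unset Strict Implicit.
Unset Printing Implicit Defensive.

Import Order.TTheory GRing.Theory Num.Theory.
Import numFieldNormedType.Exports.

Local Open Scope classical_set_scope.
Local Open Scope card_scope.

(** * Comparison of cardinals and transfinite selection *)

Lemma card_le_total T U (A : set T) (B : set U) : A #<= B \/ B #<= A.
Proof.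
(* Tagged copies bring both sets into the single type that [min_card_le] requires. *)
have inlA : @inl T U @` A #= A by apply: inj_card_eq => ? ? _ _ [].
have inrB : @inr T U @` B #= B by apply: inj_card_eq => ? ? _ _ [].
have [|C [->|->] minC] :=
    @min_card_le _ [set @inl T U @` A; @inr T U @` B].
- by exists (inl @` A); left.
- by left; rewrite -(card_le_eql inlA) -(card_le_eqr inrB); apply: minC; right.
- by right; rewrite -(card_le_eql inrB) -(card_le_eqr inlA); apply: minC; left.
Qed.

(* If some initial segment has the cardinality of T, an injection of T into the
   least such segment pulls the well-order back to one with small segments. *)
Lemma well_order_small_segments (T : pointedType) : exists lt : rel T,
  [/\ well_founded lt, forall x y, x != y -> lt x y || lt y x
    & forall x, ~ ([set: T] #<= [set y | lt y x])].
Proof.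
have [le le_wo] := well_ordering_principle T.
have le_min (P : T -> Prop) : (exists x, P x) ->
    exists2 z, P z & forall y, P y -> le z y.
  move=> [x Px]; have [|z [[/asboolP Pz zmin] _]] := le_wo (fun y => `[< P y >]).
    by exists x; apply/asboolP.
  by exists z => // y Py; apply: zmin; apply/asboolP.
pose lt x y := ~~ le y x.
have lt_wf : well_founded lt.
  move=> x; apply: contrapT => nx.
  have [z nz zmin] := le_min (fun y => ~ Acc lt y) (ex_intro _ x nx).
  by apply: nz; constructor => y /negP nzy; apply: contrapT => /zmin.
have lt_total x y : x != y -> lt x y || lt y x.
  have le_chain : wo_chain le predT by move=> A _; exact: le_wo.
  apply: contraNT; rewrite negb_or !negbK andbC => le_xy.
  by apply/eqP/(wo_chain_antisymmetric le_chain).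
have [big|nbig] := pselect (exists x, [set: T] #<= [set y | lt y x]); last first.
  by exists lt; split=> // x bigx; apply: nbig; exists x.
have [z /pcard_leP/injfunPex[g glt ginj] zmin] := le_min _ big.
have {}ginj : injective g by move=> x y; apply: ginj; rewrite inE.
exists (fun x y => lt (g x) (g y)); split.
- suff acc u : Acc lt u -> forall x, g x = u -> Acc (fun x y => lt (g x) (g y)) x.
    by move=> x; apply: acc (lt_wf (g x)) _ _.
  elim=> {}u _ IHu x gx.
  constructor => y yx.
  by apply: (IHu (g y)) => //; rewrite -gx.
- by move=> x y xy; apply: lt_total; rewrite (inj_eq ginj).
(* If the segment below [x] were large, [g] would inject it into the segment below [g x]. As [g x]
   lies below [z], this contradicts the minimality of [z]. *)
- move=> x bigx; have /negP := glt x I; apply; apply: zmin.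
  apply: (card_le_trans bigx).
  rewrite -(card_le_eql (@inj_card_eq _ _ _ g _)); last by move=> ? ? _ _ /ginj.
  by apply: subset_card_le => _ [y yx <-].
Qed.

(** Transfinite recursion along the order with small segments: the values chosen before stage [t]
    are too few to exhaust [A t], so a fresh one remains. *)
Lemma injective_selection (T U : pointedType) (A : T -> set U) :
  (forall t, [set: T] #<= A t) ->
  exists2 f : T -> U, injective f & forall t, A t (f t).
Proof.
move=> bigA; have [lt [lt_wf lt_total lt_small]] := well_order_small_segments T.
pose F t (rec : forall s, lt s t -> U) : U :=
  (* The default [point] is never taken: [fP] shows that the set is nonempty. *)
  xget point [set u | A t u /\ forall s (st : lt s t), rec s st <> u].
pose f := Fix lt_wf (fun=> U) F.
have fE t : f t = xget point [set u | A t u /\ forall s, lt s t -> f s <> u].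
  rewrite /f Fix_eq // => s r r' rr'; congr (xget _ _); apply/funext => u.
  by apply/propext; split=> -[Au ru]; split=> // v vt;
    [rewrite -rr'|rewrite rr']; exact: ru.
have fP t : A t (f t) /\ forall s, lt s t -> f s <> f t.
  suff /(xgetPex point) : exists u, A t u /\ forall s, lt s t -> f s <> u.
    by rewrite -fE.
  apply: contrapT => none.
  apply: (lt_small t); apply: (card_le_trans (bigA t)).
  apply: (@card_le_trans _ _ _ (f @` [set s | lt s t])); last exact: card_image_le.
  apply: subset_card_le => u Au; apply: contrapT => nu; apply: none.
  by exists u; split=> // s st su; apply: nu; exists s.
exists f => [s t fst|t]; last by have [] := fP t.
apply/eqP; apply: contraPT fst => /lt_total/orP[st|ts].
  by have [_] := fP t; exact.
by have [_ fts] := fP s => /esym; exact: fts.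
Qed.

(** * Dense open sets of reals and their intersections *)

Local Open Scope ring_scope.

Lemma open_itvcc_subset (R : realType) (V : set R) x : open V -> V x ->
  exists2 e : R, 0 < e & `[x - e, x + e] `<=` V.
Proof.
move=> oV Vx; have /nbhs_ballP[e /= e0 eV] : nbhs x V by exact: open_nbhs_nbhs.
exists (e / 2); first by lra.
move=> y /=; rewrite in_itv/= => /andP[? ?]; apply: eV.
by rewrite ball_itv/= in_itv/=; lra.
Qed.

Lemma open_not_subset1 (R : realType) (V : set R) x :
  open V -> V x -> exists2 y, V y & y <> x.
Proof.
move=> oV Vx; have [e e0 eV] := open_itvcc_subset oV Vx.
exists (x + e); last by lra.
by apply: eV; rewrite /= in_itv/=; lra.
Qed.

Section cantor_scheme.
Variables (R : realType) (V : nat -> set R).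
Hypotheses (oV : forall n, open (V n)) (dV : forall n, dense (V n)).

(** The condition [p.1 < p.2] stands under the existential so that choice yields a function on all
    pairs. *)
Let shrink n (p : R * R) : exists q : R * R, p.1 < p.2 ->
  [/\ p.1 <= q.1, q.1 < q.2, q.2 <= p.2 & `[q.1, q.2] `<=` V n].
Proof.
have [p12|] := boolP (p.1 < p.2); last by exists p.
have [||x [px Vx]] := @dV n [set` `]p.1, p.2[].
- by exists ((p.1 + p.2) / 2); rewrite /= in_itv/=; lra.
- exact: itv_open.
have [||e e0 eV] := @open_itvcc_subset _ ([set` `]p.1, p.2[] `&` V n) x => //.
  by apply: openI => //; exact: itv_open.
have := eV (x - e); have := eV (x + e); rewrite /= !in_itv/=.
move=> []; first by lra.
move=> /andP[_ ?] _ []; first by lra.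
move=> /andP[? _] _.
exists (x - e, x + e) => _; split=> /=; [lra..|].
by move=> y /eV[].
Qed.

(** Leaving out the middle third keeps the two closed intervals disjoint. *)
Let third (b : bool) (p : R * R) : R * R :=
  if b then (p.1, p.1 + (p.2 - p.1) / 3) else (p.2 - (p.2 - p.1) / 3, p.2).

(** A set [A] of naturals codes a branch of a Cantor scheme: stage [n] passes to a left or right
    third according to whether [n] is in [A], then shrinks into [V n]. The branch closes down on a
    point of every [V n], and different branches on different points. *)
Lemma cantor_scheme_card : [set: set nat] #<= \bigcap_n V n.
Proof.
have /choice[F FP] : forall np : nat * (R * R), exists q, np.2.1 < np.2.2 ->
    [/\ np.2.1 <= q.1, q.1 < q.2, q.2 <= np.2.2 & `[q.1, q.2] `<=` V np.1].
  by move=> [n p]; exact: shrink.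
pose J (A : set nat) := fix J n : R * R :=
  if n is m.+1 then F (m, third `[< A m >] (J m)) else (0, 1).
have J_lt A n : (J A n).1 < (J A n).2.
  elim: n => [|n IHn] /=; first by lra.
  by have [|] := FP (n, third `[< A n >] (J A n)) => //=; case: asboolP => _ /=; lra.
have JP A n : [/\ (third `[< A n >] (J A n)).1 <= (J A n.+1).1,
    (J A n.+1).2 <= (third `[< A n >] (J A n)).2 &
    `[(J A n.+1).1, (J A n.+1).2] `<=` V n].
  have [|] := FP (n, third `[< A n >] (J A n)) => //=.
  by have := J_lt A n; case: asboolP => _ /=; lra.
have J_nested A n : (J A n).1 <= (J A n.+1).1 /\ (J A n.+1).2 <= (J A n).2.
  by have [+ + _] := JP A n; have := J_lt A n; case: asboolP => _ /=; lra.
have J_cross A m n : (J A m).1 <= (J A n).2.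
  have J1 k : (J A m).1 <= (J A (m + k)%N).1.
    elim: k => [|k]; first by rewrite addn0.
    by rewrite addnS; have [+ _] := J_nested A (m + k)%N; lra.
  have J2 k : (J A (n + k)%N).2 <= (J A n).2.
    elim: k => [|k]; first by rewrite addn0.
    by rewrite addnS; have [_] := J_nested A (n + k)%N; lra.
  by have := J1 n; have := J2 m; have := J_lt A (m + n)%N; rewrite (addnC n); lra.
pose pt A := sup (range (fun n => (J A n).1)).
have pt_in A n : (J A n).1 <= pt A <= (J A n).2.
  apply/andP; split.
    by apply: ub_le_sup; [exists (J A 0%N).2 => _ [m _ <-]|exists n].
  by apply: ge_sup; [exists (J A 0%N).1, 0%N|move=> _ [m _ <-]].
have pt_inj : injective pt.
  move=> A B ptAB.
  (* The common point lies in the thirds that [A] and [B] choose from the same interval, so these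
     are the same third. *)
  have bits n : J A n = J B n -> `[< A n >] = `[< B n >].
    have [[+ + _] [+ + _]] := (JP A n, JP B n).
    have := pt_in A n.+1; have := pt_in B n.+1; rewrite ptAB.
    move=> ? ? + + + + JAB; have := J_lt B n; rewrite JAB.
    by case: asboolP; case: asboolP => //= ? ?; lra.
  have JAB n : J A n = J B n by elim: n => //= n IHn; rewrite IHn (bits n).
  by apply/funext => n; rewrite -[A n]asboolE -[B n]asboolE bits.
rewrite -(card_le_eql (@inj_card_eq _ _ setT pt _)); last by move=> ? ? _ _ /pt_inj.
apply: subset_card_le => _ [A _ <-] n _; have [_ _] := JP A n; apply.
by rewrite /= in_itv; exact: (pt_in A n.+1).
Qed.
End cantor_scheme.

Lemma comeager_card (R : realType) (J : countType) (U : J -> set R) :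
  (forall i, open (U i)) -> (forall i, dense (U i)) ->
  [set: set nat] #<= \bigcap_i U i.
Proof.
(* Codes of no index get [setT], which leaves the intersection unchanged. *)
move=> oU dU; pose V n := if unpickle n is Some i then U i else setT.
apply: (@card_le_trans _ _ _ (\bigcap_n V n)).
  apply: cantor_scheme_card => n; rewrite /V; case: unpickle => //.
    exact: openT.
  by move=> O [x Ox] _; exists x.
by apply: subset_card_le => x Vx i _; have := Vx (pickle i) I; rewrite /V pickleK.
Qed.

Lemma dense_rat (R : realType) (V : set R) :
  (forall p q : rat, p < q -> exists2 x, ratr p < x < ratr q & V x) -> dense V.
Proof.
move=> Vpq O [x Ox] oO; have [e e0 eO] := open_itvcc_subset oO Ox.
have /rat_in_itvoo[p] : x - e < x by lra.
have /rat_in_itvoo[q] : x < x + e by lra.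
rewrite !in_itv/= => /andP[xq qe] /andP[ep px].
have [|y /andP[py yq] Vy] := Vpq p q.
  by rewrite -(ltr_rat R) (lt_trans px xq).
by exists y; split=> //; apply: eO; rewrite /= in_itv/=; lra.
Qed.

(** * Category and the cross topology *)

Lemma dense_setC_closure (T : topologicalType) (A : set T) :
  nowhere_dense A -> dense (~` closure A).
Proof.
move=> A0 O [x Ox] oO; apply: contrapT => OA.
suff : (closure A)° x by rewrite A0.
apply: (filterS _ (open_nbhs_nbhs (conj oO Ox))) => y Oy.
by apply: contrapT => nAy; apply: OA; exists y.
Qed.

Lemma nwd_meager (T : topologicalType) : nwd T `<=` meagers T.
Proof.
by move=> A A0; exists (fun=> A) => //; apply/seteqP; split=> [x Ax|x [n]//];
  exists 0%N.
Qed.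

Section cross_plane_cofinality.
Variable R : realType.

(** A rectangle with open sides is cross-open, since each of its sections is a side or empty. *)
Lemma rectangle_meets_dense (G : set (cross_plane R)) (A B : set R) :
  dense G -> open A -> open B -> A !=set0 -> B !=set0 ->
  exists2 x, A x & exists2 y, B y & G (x, y).
Proof.
move=> dG oA oB [a Aa] [b Bb].
have oAB : open (A `*` B : set (cross_plane R)).
  rewrite open_crossE; split=> [x|y].
    have [Ax|nAx] := pselect (A x).
      by rewrite (_ : xsection _ _ = B)// xsectionE; apply/seteqP; split=> y //= [].
    by rewrite (_ : xsection _ _ = set0) ?xsectionE; [exact: open0|];
      apply/seteqP; split=> y //= [].
  have [By|nBy] := pselect (B y).
    by rewrite (_ : ysection _ _ = A)// ysectionE; apply/seteqP; split=> x //= [].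
  by rewrite (_ : ysection _ _ = set0) ?ysectionE; [exact: open0|];
    apply/seteqP; split=> x //= [].
have [|[x y] [[Ax By] Gxy]] := dG _ _ oAB; first by exists (a, b).
by exists x => //; exists y.
Qed.

Lemma comeager_sections_card (G : nat -> set (cross_plane R)) :
  (forall n, open (G n)) -> (forall n, dense (G n)) ->
  exists2 X : set R, [set: set nat] #<= X &
    forall x, X x -> [set: set nat] #<= [set y | forall n, G n (x, y)].
Proof.
move=> oG dG.
pose U (i : nat * (rat * rat)) : set R := let: (n, (p, q)) := i in
  if p < q then \bigcup_(y in [set` `]ratr p, ratr q[]) ysection (G n) y else setT.
exists (\bigcap_i U i) => [|x Ux].
  apply: comeager_card => -[n [p q]]; rewrite /U; case: ifPn => pq.
  - by apply: bigcup_open => y _; have [_] := oG n; apply.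
  - exact: openT.
  - move=> O O0 oO.
    have pqR : ratr p < ratr q :> R by rewrite ltr_rat.
    have pq0 : [set` `]ratr p : R, ratr q[] !=set0.
      by exists ((ratr p + ratr q) / 2); rewrite /= in_itv/=; lra.
    have oI : open [set` `]ratr p : R, ratr q[] by exact: itv_open.
    have [x Ox [y pqy Gxy]] := rectangle_meets_dense (dG n) oO oI O0 pq0.
    by exists x; split=> //; exists y => //; apply/ysectionP.
  - by move=> O [y Oy] _; exists y.
(* Membership of [x] in every [U i] makes each open section [xsection (G n) x] meet all rational
   intervals, hence dense. *)
suff -> : [set y | forall n, G n (x, y)] = \bigcap_n xsection (G n) x.
  apply: comeager_card => n; first by have [+ _] := oG n; apply.
  apply: dense_rat => p q pq; have := Ux (n, (p, q)) I; rewrite /U pq.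
  move=> [y + /ysectionP Gxy]; rewrite /= in_itv/= => pyq.
  by exists y => //; apply/xsectionP.
apply/seteqP; split=> y Gy n; first by move=> _; apply/xsectionP/Gy.
exact/xsectionP/Gy.
Qed.

Lemma meager_sections_card (M : set (cross_plane R)) : meager M ->
  exists2 X : set R, [set: set nat] #<= X &
    forall x, X x -> [set: set nat] #<= [set y | ~ M (x, y)].
Proof.
move=> [N N0 ->].
have [|n|X cX XP] := @comeager_sections_card (fun n => ~` closure (N n)).
- by move=> n; exact: closed_openC (@closed_closure _ _).
- exact: dense_setC_closure.
exists X => // x /XP; move/card_le_trans; apply.
by apply: subset_card_le => y nN [n _ Nxy]; apply: (nN n); exact: subset_closure.
Qed.

(** Each vertical or horizontal line meets the range in at most one point, so the range is
    cross-closed. An interior point would give a nonempty open subset of the reals with a single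
    point. *)
Lemma nowhere_dense_injective_range (J : Type) (f g : J -> R) :
  injective f -> injective g ->
  nowhere_dense (range (fun i => (f i, g i)) : set (cross_plane R)).
Proof.
move=> f_inj g_inj; set Y : set (cross_plane R) := range _.
have openC_sub1 (A : set R) : (forall x y, A x -> A y -> x = y) -> open (~` A).
  move=> A1; have [[a Aa]|nA] := pselect (A !=set0).
    rewrite (_ : A = [set a]); last first.
      by apply/seteqP; split=> [x Ax|x ->//]; exact: A1.
    exact/closed_openC/accessible_closed_set1/hausdorff_accessible/Rhausdorff.
  rewrite (_ : A = set0) ?setC0; first exact: openT.
  by apply/seteqP; split=> // x Ax; apply: nA; exists x.
have Yx x : open (~` xsection Y x).
  apply: openC_sub1 => _ _ /xsectionP[i _ [<- <-]] /xsectionP[j _ [/f_inj-> <-]].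
  by [].
have Yy y : open (~` ysection Y y).
  apply: openC_sub1 => _ _ /ysectionP[i _ [<- <-]] /ysectionP[j _ [<- /g_inj->]].
  by [].
have cY : closed Y.
  rewrite -openC open_crossE; split=> z.
    have -> : xsection (~` Y : set (R * R)) z = ~` xsection Y z by rewrite !xsectionE.
    exact: Yx.
  have -> : ysection (~` Y : set (R * R)) z = ~` ysection Y z by rewrite !ysectionE.
  exact: Yy.
rewrite /nowhere_dense -(proj1 (closure_id Y) cY); apply/seteqP; split=> // -[x y] Yxy.
have [/(_ x) oYx _] := @open_interior _ Y.
have [|z] := @open_not_subset1 _ _ y oYx; first exact/xsectionP.
move=> /xsectionP/interior_subset[i _ [fi <-]].
have [j _ [fj <-]] := interior_subset Yxy.
by apply; congr g; apply: f_inj; rewrite fi fj.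
Qed.

(** Selection runs twice: first distinct abscissae [f i] in [X i], then distinct ordinates [g i]
    among the continuum many that keep [(f i, g i)] outside [M i]. *)
Lemma diagonal_nowhere_dense (J : pointedType) (M : J -> set (cross_plane R)) :
  [set: J] #<= [set: set nat] -> (forall i, meager (M i)) ->
  exists2 Y : set (cross_plane R), nowhere_dense Y & forall i, ~ Y `<=` M i.
Proof.
move=> cI meagerM.
have /choice[X XP] i : exists X : set R, [set: set nat] #<= X /\
    forall x, X x -> [set: set nat] #<= [set y | ~ M i (x, y)].
  by have [X] := meager_sections_card (meagerM i); exists X.
have [|f f_inj fX] := @injective_selection J R X.
  by move=> i; apply: card_le_trans cI _; have [] := XP i.
have [|g g_inj gM] := @injective_selection J R (fun i => [set y | ~ M i (f i, y)]).
  by move=> i; apply: card_le_trans cI _; have [_] := XP i; apply.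
exists (range (fun i => (f i, g i))); first exact: nowhere_dense_injective_range.
by move=> i /(_ (f i, g i)) YM; apply: (gM i); apply: YM; exists i.
Qed.

(** Letting [F] range between the two ideals treats both at once: the diagonal set is nowhere dense,
    yet escapes even meager sets. *)
Lemma continuum_lt_cof (F : set (set (cross_plane R))) :
  nwd (cross_plane R) `<=` F -> F `<=` meagers (cross_plane R) ->
  [set: set nat] #< cof F.
Proof.
move=> nwdF Fmeager; have [[cofF cofP] _] := cofP F.
suff ncof : ~ (cof F #<= [set: set nat]).
  by apply/andP; split; [have [] := card_le_total [set: set nat] (cof F)|apply/negP].
move=> /pcard_surjP[w wsurj].
(* The surjection [w] covers [cof F] but may also take values outside it; these are replaced by the
   meager set [set0]. *)
pose M A := if `[< cof F (w A) >] then w A else set0.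
have [||Y Y0 YM] := @diagonal_nowhere_dense (set nat) M; first exact: card_lexx.
  move=> A; rewrite /M; case: asboolP => [cofA|_]; first exact/Fmeager/cofF.
  by apply: nwd_meager; rewrite /nwd /nowhere_dense closure0 interior0.
have [Z cofZ YZ] := cofP Y (nwdF Y Y0).
have [A _ wA] := wsurj Z cofZ; apply: (YM A).
by rewrite /M wA asboolT.
Qed.

End cross_plane_cofinality.

Theorem theorem7 (R : realType) :
  [set: set nat] #< cof (nwd (cross_plane R)) /\
  [set: set nat] #< cof (meagers (cross_plane R)).
Proof.
split; apply: continuum_lt_cof => //; exact: nwd_meager.
Qed.
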